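(* Let $N$ and $r$ be relatively prime positive integers greater than $1$, and let $\bar{r}$ be an integer such that $r\bar{r}\equiv 1 \pmod N$. Let $\Gamma$ be the $4$-valent graph on $\mathbb{Z}/N\mathbb{Z}$ in which each vertex $x$ is connected to the vertices $r(x+1)$, $r(x-1)$, $\bar{r}x+1$ and $\bar{r}x-1$. Then there exists a constant $c>0$, depending only on $r$, such that every nontrivial eigenvalue $\lambda$ of the adjacency matrix of $\Gamma$ either satisfies $$|\lambda| \le 4 - \frac{c}{(\log N)^2},$$ or is of the form $\lambda = 4\cos(2\pi k/N)$ for some $k$ satisfying $rk\equiv k \pmod N$. In particular, if $N$ is a power of $2$ and $\gcd(r-1,N)=2$, then $\Gamma$ is a bipartite graph for which all eigenvalues not equal to $\pm 4$ satisfy $|\lambda| \le 4 - \frac{c}{(\log N)^2}$.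
   Context: The edge relation is symmetric (if $y=r(x\pm1)$ then $x=\bar{r}y\mp 1$), so $\Gamma$ is an undirected $4$-regular graph (edges counted with multiplicity). Its adjacency operator acts on functions $f:\mathbb{Z}/N\mathbb{Z}\to\mathbb{C}$ by $(Af)(x)=\sum_{y\sim x} f(y)$, the sum running over the four neighbors of $x$ listed above, with multiplicity. The trivial eigenvalue is $4$, attained by the constant function; ''nontrivial eigenvalues'' are the eigenvalues of $A$ restricted to the orthogonal complement of the constant functions. *)

(* Defs.v *)
From HB Require Import structures.
From mathcomp Require Import all_boot all_order all_algebra.
From mathcomp Require Import all_classical all_reals all_analysis.
From mathcomp Require Import complex.
Set Implicit Arguments. Unset Strict Implicit. Unset Printing Implicit Defensive.
Import Order.TTheory GRing.Theory Num.Theory.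
Local Open Scope ring_scope.

Definition nbrs (N r : nat) (rbar : int) (x : 'Z_N) : seq 'Z_N :=
  [:: r%:R * (x + 1); r%:R * (x - 1); rbar%:~R * x + 1; rbar%:~R * x - 1].

Definition adjop (R : realType) (N r : nat) (rbar : int)
    (f : 'Z_N -> R[i]) : 'Z_N -> R[i] :=
  fun x => \sum_(y <- nbrs r rbar x) f y.

Definition is_eigenvalue (R : realType) (N r : nat) (rbar : int) (l : R[i]) : Prop :=
  exists f : 'Z_N -> R[i], (exists x, f x != 0) /\
    forall x, adjop r rbar f x = l * f x.

(* lambda is a nontrivial eigenvalue: an eigenvalue of A restricted to the
   orthogonal complement of the constant functions (an A-invariant subspace),
   i.e. it has a nonzero eigenfunction f with <f, 1> = sum_x f x = 0. *)
Definition is_nontrivial_eigenvalue (R : realType) (N r : nat) (rbar : int) (l : R[i]) : Prop :=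
  exists f : 'Z_N -> R[i], (exists x, f x != 0) /\ (\sum_x f x = 0) /\
    forall x, adjop r rbar f x = l * f x.

Definition is_bipartite (N r : nat) (rbar : int) : Prop :=
  exists col : 'Z_N -> bool, forall x y, y \in nbrs r rbar x -> col x != col y.

(* Main.v *)
Require Import Defs.
From HB Require Import structures.
From mathcomp Require Import all_boot all_order all_algebra.
From mathcomp Require Import all_classical all_reals all_analysis.
From mathcomp Require Import complex.
From mathcomp Require Import zify ring lra.
Set Implicit Arguments. Unset Strict Implicit. Unset Printing Implicit Defensive.
Import Order.TTheory GRing.Theory Num.Theory.
Local Open Scope ring_scope.

(* On the Fourier side, the adjacency operator is a weighted cycle on each orbit
   of k |-> r k: the edge joining k / r and k has weight w k = 2 cos (2 pi k / N).
   An eigenvector charging a fixed point k of multiplication by r has eigenvalue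
   2 w k.  Otherwise, for any positive t, the inequality
   2 |w k| a b <= (w k)^2 / t k * a^2 + t k * b^2 summed over the edges bounds
   |l| by the largest value of (w k)^2 / t k + t (r k).  Let q k be the distance
   from 2 k to the multiples of N.  While q k <= N / (2 r), one has
   q (r k) = r * q k, so the choice t = 2 + (alpha / ln N) (1 - ln q / ln N)
   loses a fixed multiple of 1 / (ln N)^2 at each step; when q k is larger,
   (w k)^2 is bounded away from 4, which pays for resetting t. *)

(** * A Schur test along a permutation *)

Lemma le_of_weighted_schur (R : realFieldType) (T : finType) (s s' : T -> T)
    (w t a : T -> R) (lam m : R) :
  cancel s s' -> cancel s' s ->
  (forall k, 0 < t k) -> (forall k, 0 <= a k) -> (exists k, a k != 0) ->
  (forall k, lam * a k <= w k * a (s' k) + w (s k) * a (s k)) ->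
  (forall k, a k != 0 -> w k ^+ 2 / t k + t (s k) <= m) ->
  lam <= m.
Proof.
move=> ss' s's t_gt0 a_ge0 [k0 ak0] eig bound.
have sum_gt0 : 0 < \sum_k a k ^+ 2.
  rewrite (bigD1 k0) //= ltr_pwDl ?exprn_even_gt0 //.
  by apply: sumr_ge0 => k _; exact: sqr_ge0.
rewrite -(ler_pM2r sum_gt0).
have le1 : lam * (\sum_k a k ^+ 2) <=
    \sum_k w k * a k * a (s' k) + \sum_k w (s k) * a (s k) * a k.
  rewrite mulr_sumr -big_split; apply: ler_sum => k _ /=.
  have := ler_wpM2r (a_ge0 k) (eig k); lra.
(* Sums are invariant under the bijection [s]: this identifies the two cross sums, and later turns
   [t k * a (s' k) ^+ 2] into [t (s k) * a k ^+ 2]. *)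
have shift (F : T -> R) : \sum_k F k = \sum_k F (s k).
  by rewrite (reindex s) //; exists s' => k _; [exact: ss' | exact: s's].
apply: (le_trans le1).
have -> : \sum_k w (s k) * a (s k) * a k = \sum_k w k * a k * a (s' k).
  by rewrite [RHS]shift; apply: eq_bigr => k _; rewrite ss'.
rewrite -big_split /=.
have le2 : \sum_k (w k * a k * a (s' k) + w k * a k * a (s' k)) <=
    \sum_k w k ^+ 2 / t k * a k ^+ 2 + \sum_k t k * a (s' k) ^+ 2.
  rewrite -big_split; apply: ler_sum => k _ /=; rewrite -subr_ge0.
  have tk0 : t k != 0 by rewrite gt_eqF.
  have -> : w k ^+ 2 / t k * a k ^+ 2 + t k * a (s' k) ^+ 2 -
      (w k * a k * a (s' k) + w k * a k * a (s' k)) =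
      (w k * a k - t k * a (s' k)) ^+ 2 / t k by field.
  by rewrite divr_ge0 ?sqr_ge0 // ltW.
apply: (le_trans le2); rewrite (shift (fun k => t k * _)) -big_split mulr_sumr.
apply: ler_sum => k _ /=; rewrite ss' -mulrDl.
have [->|ak] := eqVneq (a k) 0; first by rewrite expr0n !mulr0.
by rewrite ler_wpM2r ?sqr_ge0 ?bound.
Qed.

(** * Distance to the multiples of [N] *)

Definition dist_multiple (N n : nat) : nat := minn (n %% N) (N - n %% N).

Lemma dist_multiple_gt0 (N n : nat) :
  (0 < N)%N -> (0 < dist_multiple N n)%N = ~~ (N %| n)%N.
Proof.
by move=> N_gt0; rewrite /dist_multiple leq_min subn_gt0 ltn_pmod // andbT lt0n.
Qed.

Lemma double_dist_multiple_le (N n : nat) : ((dist_multiple N n).*2 <= N)%N.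
Proof. by rewrite /dist_multiple; lia. Qed.

Lemma dist_multipleM (N r n : nat) : (1 < N)%N ->
  ((r * dist_multiple N n).*2 <= N)%N ->
  dist_multiple N (r * n) = (r * dist_multiple N n)%N.
Proof.
move=> N_gt1; rewrite /dist_multiple.
have : (n %% N < N)%N by rewrite ltn_pmod //; lia.
rewrite -(modnMmr r n N); move: (n %% N)%N => v v_lt.
have [le_v|lt_v] := leqP v (N - v).
  move=> small.
  by rewrite modn_small; lia.
move=> small.
have [->|r_gt0] := posnP r; first by rewrite !mul0n mod0n min0n.
(* Here [v] lies closer to [N] than to 0, and [r * v] falls short of [r * N] by [r * (N - v)], at
   most half a period. *)
have -> : (r * v)%N = (r.-1 * N + (N - r * (N - v)))%N by nia.
rewrite modnMDl modn_small; last by nia.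
by nia.
Qed.

(** * Cosines, characters and the Fourier transform modulo [N] *)

Lemma cos_lt1 (R : realType) (x : R) : 0 < x <= pi -> cos x < 1.
Proof.
move=> /andP[x_gt0 x_le]; rewrite -(cos0 R) ltr_cos // in_itv /= ?lexx ?pi_ge0 //.
by rewrite x_le ltW.
Qed.

Section Character.
Variables (R : realType) (N : nat).
Hypothesis N_gt1 : (1 < N)%N.
Let N_neq0 : N%:R != 0 :> R. Proof. by rewrite pnatr_eq0; lia. Qed.
Let N_gt0 : 0 < N%:R :> R. Proof. by rewrite ltr0n; lia. Qed.

Definition angle (n : nat) : R := 2 * pi * n%:R / N%:R.
Definition unit_root : R[i] := (cos (angle 1) +i* sin (angle 1))%C.

Lemma angleD m n : angle (m + n) = angle m + angle n.
Proof. by rewrite /angle natrD; field. Qed.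

Lemma unit_rootX n : unit_root ^+ n = (cos (angle n) +i* sin (angle n))%C.
Proof.
elim: n => [|n IH]; first by rewrite expr0 /angle mulr0 mul0r cos0 sin0.
rewrite exprS IH -[n.+1]add1n angleD cosD sinD /unit_root.
by simpc; congr (_ +i* _)%C; ring.
Qed.

Lemma unit_root_period : unit_root ^+ N = 1.
Proof.
by rewrite unit_rootX /angle mulfK // mulr_natl cos2pi sin2pi.
Qed.

Lemma cos_angle_mod n : cos (angle (n %% N)) = cos (angle n).
Proof.
have := expr_mod n unit_root_period.
by rewrite !unit_rootX => -[].
Qed.

Lemma cos_angle_rev n : (n <= N)%N -> cos (angle (N - n)) = cos (angle n).
Proof.
move=> le_n; rewrite -[RHS]cosN -[RHS](cosD2pi (- angle n)); congr cos.
by rewrite /angle natrB // -mulr_natl; field.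
Qed.

Lemma cos_dist_multiple n : cos (angle (dist_multiple N n)) = cos (angle n).
Proof.
rewrite -[RHS]cos_angle_mod /dist_multiple.
by case: leqP => // _; rewrite cos_angle_rev // ltnW // ltn_pmod //; lia.
Qed.

Lemma cos_angle_lt1 n : ~~ (N %| n)%N -> cos (angle n) < 1.
Proof.
rewrite -dist_multiple_gt0 ?(ltnW N_gt1) // -cos_dist_multiple => q_gt0.
apply: cos_lt1; have := double_dist_multiple_le N n.
rewrite -(ler_nat R) -muln2 natrM => q_le; have pi0 := pi_gt0 R.
rewrite /angle; apply/andP; split.
  by rewrite divr_gt0 // !mulr_gt0 // ltr0n.
rewrite ler_pdivrMr //.
by rewrite [leLHS](_ : _ = pi * ((dist_multiple N n)%:R * 2)) ?ler_pM2l //; ring.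
Qed.

Lemma sqr_cos_angle n : (2 * cos (angle n)) ^+ 2 = 2 + 2 * cos (angle n.*2).
Proof.
by rewrite -addnn angleD -[angle n + _]/(angle n *+ 2) cos_mulr2n; ring.
Qed.

(** By the double angle formula the square depends only on [n.*2]. The hypothesis places the angle
    of its distance in [pi / r, pi], where the cosine decreases. *)
Lemma sqr_cos_angle_le_far (r n : nat) : (1 < r)%N ->
  (N <= (r * dist_multiple N n.*2).*2)%N ->
  (2 * cos (angle n)) ^+ 2 <= 2 + 2 * cos (pi / r%:R).
Proof.
move=> r_gt1 far; rewrite sqr_cos_angle -cos_dist_multiple lerD2l ler_pM2l //.
have := double_dist_multiple_le N n.*2; move: far.
set q := dist_multiple _ _.
rewrite -!muln2 -!(ler_nat R) !natrM => far near.
have pi0 := pi_gt0 R; have r0 : 0 < r%:R :> R by rewrite ltr0n ltnW.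
have r1 : 1 <= r%:R :> R by rewrite ler1n ltnW.
have angleE : angle q = pi * (q%:R * 2 / N%:R) by rewrite /angle; ring.
have r_itv : (pi / r%:R : R) \in `[0, pi].
  rewrite in_itv /= divr_ge0 ?(ltW pi0) ?(ltW r0) //.
  by rewrite ler_pdivrMr // ler_peMr // ltW.
have q_itv : angle q \in `[0, pi].
  rewrite in_itv /= angleE mulr_ge0 ?(ltW pi0) ?divr_ge0 //.
  by rewrite ler_piMr ?(ltW pi0) // ler_pdivrMr // mul1r.
rewrite leNgt ltr_cos // -leNgt angleE ler_pM2l //.
rewrite ler_pdivlMr // mulrC ler_pdivrMr //; lra.
Qed.

Definition chi (k : 'Z_N) : R[i] := unit_root ^+ k.

Lemma ltn_Zp (k : 'Z_N) : (k < N)%N.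
Proof. exact: leq_trans (ltn_ord k) (eq_leq (Zp_cast N_gt1)). Qed.

Let chi_mod n (k : 'Z_N) : k = (n %% N)%N :> nat -> chi k = unit_root ^+ n.
Proof. by rewrite /chi => ->; rewrite expr_mod // unit_root_period. Qed.

Lemma chi0 : chi 0 = 1.
Proof. by rewrite /chi expr0. Qed.

Lemma chiD (j k : 'Z_N) : chi (j + k) = chi j * chi k.
Proof. by rewrite -exprD; apply: chi_mod; congr (_ %% _)%N; rewrite Zp_cast. Qed.

Lemma chi_neq1 (k : 'Z_N) : k != 0 -> chi k != 1.
Proof.
move=> k0; apply/eqP; rewrite /chi unit_rootX => -[cos1 _].
have /cos_angle_lt1 : ~~ (N %| k)%N.
  by rewrite gtnNdvd ?lt0n ?ltn_Zp.
by rewrite cos1 ltxx.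
Qed.

Lemma chi_addN (k : 'Z_N) : chi k + chi (- k) = ((2 * cos (angle k))%:C)%C.
Proof.
have k_lt := ltn_Zp k.
have -> : chi (- k) = unit_root ^+ (N - k).
  by apply: chi_mod; congr ((_ - _) %% _)%N; rewrite Zp_cast.
rewrite {1}/chi !unit_rootX cos_angle_rev ?(ltnW k_lt) //.
have -> : sin (angle (N - k)) = - sin (angle k).
  rewrite -sinN -(sinD2pi (- angle k)); congr sin.
  by rewrite /angle natrB ?(ltnW k_lt) // -mulr_natl; field.
by simpc; congr (_ +i* _)%C; ring.
Qed.

(** For nonzero [x], multiplying the sum by [chi x] only shifts its index, so [chi x - 1], which is
    nonzero, annihilates it. *)
Lemma sum_chi (x : 'Z_N) : \sum_k chi (k * x) = if x == 0 then N%:R else 0.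
Proof.
have [->|x0] := eqVneq x 0.
  under eq_bigr do rewrite mulr0 chi0.
  by rewrite sumr_const card_ord Zp_cast.
have cx0 : chi x - 1 != 0 by rewrite subr_eq0 chi_neq1.
apply: (mulfI cx0); rewrite mulr0 mulrBl mul1r mulr_sumr.
rewrite [X in _ - X](reindex (fun k => k + 1)) /=; last first.
  by exists (fun k => k - 1) => k _; rewrite ?addrK ?subrK.
by under [X in _ - X]eq_bigr do rewrite mulrDl mul1r addrC chiD; rewrite subrr.
Qed.

Definition fourier (f : 'Z_N -> R[i]) (k : 'Z_N) : R[i] :=
  \sum_x f x * chi (k * x).

(** Fourier inversion at [y] recovers [N%:R * f y] from the coefficients, so they cannot all
    vanish. *)
Lemma fourier_neq0 (f : 'Z_N -> R[i]) :
  (exists x, f x != 0) -> exists k, fourier f k != 0.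
Proof.
move=> [y fy]; apply/existsP; apply: contraNT fy => /existsPn fhat0.
have : \sum_k fourier f k * chi (- (k * y)) = N%:R * f y.
  under eq_bigr do rewrite /fourier mulr_suml.
  rewrite exchange_big (bigD1 y) //= [X in _ + X]big1 ?addr0 => [|x xy].
    under eq_bigr do rewrite -mulrA -chiD subrr chi0 mulr1.
    by rewrite sumr_const card_ord Zp_cast // mulr_natl.
  under eq_bigr do rewrite -mulrA -chiD -mulrBr.
  by rewrite -mulr_sumr sum_chi subr_eq0 (negPf xy) mulr0.
rewrite big1 => [/esym/eqP|k _]; last first.
  by move/negPn: (fhat0 k) => /eqP ->; rewrite mul0r.
by rewrite mulf_eq0 pnatr_eq0; case: (N) N_gt1.
Qed.

(* Fourier transform turns the graph into weighted cycles, the orbits of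
   multiplication by r, with weight 2 cos (2 pi k / N) on the edge from k / r
   to k. *)
Lemma fourier_adjop (r : nat) (rbar : int) (f : 'Z_N -> R[i]) (k : 'Z_N) :
  r%:R * rbar%:~R = 1 :> 'Z_N ->
  fourier (adjop r rbar f) k =
    ((2 * cos (angle k))%:C)%C * fourier f (rbar%:~R * k) +
    ((2 * cos (angle ((r%:R * k)%R : 'Z_N)))%:C)%C * fourier f (r%:R * k).
Proof.
move=> rV; set s : 'Z_N := r%:R in rV *; set s' : 'Z_N := rbar%:~R in rV *.
have Vr : s' * s = 1 by rewrite mulrC.
(* Each neighbor map [h] is affine. Substituting its inverse [h'] moves the frequency from [k] to
   [j] and leaves a phase [chi c]; the phases of opposite neighbors add up to a cosine. *)
have reindex_fourier c (h h' : 'Z_N -> 'Z_N) (j : 'Z_N) :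
    cancel h h' -> cancel h' h -> (forall y, k * h' y = c + j * y) ->
    \sum_x f (h x) * chi (k * x) = chi c * fourier f j.
  move=> hK h'K h'E; rewrite (reindex h') /=; last first.
    by exists h => x _; [exact: h'K | exact: hK].
  rewrite mulr_sumr; apply: eq_bigr => y _.
  by rewrite h'K h'E chiD; ring.
rewrite -!chi_addN {1}/fourier /adjop /nbrs; under eq_bigr => x _.
  rewrite !big_cons big_nil addr0 !mulrDl -/s -/s'; over.
have sK (y : 'Z_N) : s * (s' * y) = y by rewrite mulrA rV mul1r.
have s'K (y : 'Z_N) : s' * (s * y) = y by rewrite mulrA Vr mul1r.
rewrite !big_split /=.
rewrite (reindex_fourier (- k) _ (fun y => s' * y - 1) (s' * k)); last first.
- by move=> y; ring.
- by move=> y; rewrite subrK.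
- by move=> y; rewrite s'K addrK.
rewrite (reindex_fourier k _ (fun y => s' * y + 1) (s' * k)); last first.
- by move=> y; ring.
- by move=> y; rewrite addrK.
- by move=> y; rewrite s'K subrK.
rewrite (reindex_fourier (- (s * k)) _ (fun y => s * (y - 1)) (s * k)); last first.
- by move=> y; ring.
- by move=> y; rewrite s'K subrK.
- by move=> y; rewrite addrK.
rewrite (reindex_fourier (s * k) _ (fun y => s * (y + 1)) (s * k)); last first.
- by move=> y; ring.
- by move=> y; rewrite s'K addrK.
- by move=> y; rewrite subrK.
by ring.
Qed.

(** Since [k + k = 0], only the parity of [r] matters; an even unit forces [k = 0]. Hence every
    frequency at distance 0 in the weight is a fixed point. *)
Lemma natr_Zp_fixed (r : nat) (k : 'Z_N) : r%:R \is a @GRing.unit 'Z_N ->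
  (N %| (k : nat).*2)%N -> r%:R * k = k.
Proof.
move=> r_unit N_dvd; have kk : k + k = 0.
  apply/val_inj; transitivity ((k : nat).*2 %% N)%N; last exact/eqP.
  by rewrite /= addnn; congr (_ %% _)%N; rewrite Zp_cast.
have kE n : k *+ n = if odd n then k else 0.
  rewrite -[n in LHS]odd_double_half mulrnDr -muln2 mulnC mulrnA mulr2n kk.
  by rewrite mul0rn addr0; case: odd.
rewrite mulr_natl kE; case: ifPn => // r_even.
by apply: (mulrI r_unit); rewrite mulr0 mulr_natl kE (negPf r_even).
Qed.

End Character.

(** * Logarithmic weights and their decrease under multiplication by [r] *)

Section Weights.
Variables (R : realType) (r N : nat).
Hypotheses (r_gt1 : (1 < r)%N) (N_gt1 : (1 < N)%N).
Let logr : R := ln r%:R.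
Let L : R := ln N%:R.
Let logr_gt0 : 0 < logr. Proof. by rewrite ln_gt0 ?ltr1n. Qed.
Let L_gt0 : 0 < L. Proof. by rewrite ln_gt0 ?ltr1n. Qed.
Let log2_gt0 : 0 < ln 2 :> R. Proof. by rewrite ln_gt0 ?ltr1n. Qed.

(* Chosen so that [slope <= ln r], and so that raising the weight by [slope / L]
   is affordable at an edge whose weight is at most [2 |cos (pi / (2 r))|]. *)
Definition slope : R :=
  Num.min (ln r%:R)
    ((1 - cos (pi / r%:R)) / ((ln 2)^-1 + ln r%:R / 2 / (ln 2) ^+ 2)).

(** Half of the numerator of the drop [slope * ln r / (ln N) ^ 2] per multiplication by [r]; the
    other half absorbs a second-order error. *)
Definition gap : R := slope * ln r%:R / 2.

Definition edge_weight (q : nat) : R :=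
  2 + slope / ln N%:R * (1 - ln q%:R / ln N%:R).

Lemma slope_gt0 : 0 < slope.
Proof.
have pi0 := pi_gt0 R; have r0 : 0 < r%:R :> R by rewrite ltr0n ltnW.
rewrite /slope lt_min logr_gt0 divr_gt0 ?subr_gt0 //.
  apply: cos_lt1; rewrite divr_gt0 //= ler_pdivrMr // ler_peMr ?ltW //.
  by rewrite ltr1n.
by rewrite addr_gt0 ?invr_gt0 // !divr_gt0 // exprn_gt0.
Qed.

Lemma gap_gt0 : 0 < gap.
Proof. by rewrite divr_gt0 // mulr_gt0 ?slope_gt0. Qed.

Lemma ln_nat_ge0 (n : nat) : 0 <= ln n%:R :> R.
(* [ln 0] is 0 by convention, so the weight bounds also cover distance 0. *)
Proof. by case: n => [|n]; [rewrite ln0 | rewrite ln_ge0 // ler1n]. Qed.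

Lemma ln_nat_le (m n : nat) : (m <= n)%N -> ln m%:R <= ln n%:R :> R.
Proof.
case: m => [_|m lt_mn]; first by rewrite ln0 // ln_nat_ge0.
by rewrite ler_ln ?posrE ?ltr0n ?ler_nat // (leq_trans _ lt_mn).
Qed.

Lemma edge_weight_ge2 (q : nat) : (q <= N)%N -> 2 <= edge_weight q.
Proof.
move=> q_le; rewrite /edge_weight lerDl mulr_ge0 ?divr_ge0 ?(ltW slope_gt0) //.
  exact: ltW.
by rewrite subr_ge0 ler_pdivrMr // mul1r ln_nat_le.
Qed.

Lemma edge_weight_le (q : nat) : edge_weight q <= 2 + slope / L.
Proof.
rewrite /edge_weight lerD2l ler_piMr ?divr_ge0 ?(ltW slope_gt0) ?(ltW L_gt0) //.
by rewrite gerBl divr_ge0 ?ln_nat_ge0 ?(ltW L_gt0).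
Qed.

Lemma edge_weight_near (q : nat) (w : R) : w ^+ 2 <= 4 ->
  (0 < q <= N)%N -> w ^+ 2 / edge_weight q + edge_weight (r * q) <=
    4 - gap / L ^+ 2.
Proof.
move=> w_le /andP[q_gt0 q_le]; have t_ge := edge_weight_ge2 q_le.
have t_le := edge_weight_le q.
have -> : edge_weight (r * q) = edge_weight q - slope * logr / L ^+ 2.
  rewrite /edge_weight -/L natrM lnM ?posrE ?ltr0n // ?(ltnW r_gt1) // -/logr.
  by field; rewrite gt_eqF.
rewrite /gap -/logr; set t := edge_weight q in t_ge t_le *.
have t_gt0 : 0 < t by apply: lt_le_trans t_ge.
(* The right side is the second-order Taylor polynomial of [4 / t] at 2; after multiplication by [t]
   the excess is [(t - 2) ^+ 3 / 2]. *)
have le_inv : w ^+ 2 / t <= 4 - t + (t - 2) ^+ 2 / 2.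
  rewrite ler_pdivrMr // (le_trans w_le) // -subr_ge0.
  have -> : (4 - t + (t - 2) ^+ 2 / 2) * t - 4 = (t - 2) ^+ 3 / 2 by field.
  by rewrite divr_ge0 ?exprn_ge0 // subr_ge0.
(* The first entry of the minimum in [slope] gives [slope <= ln r], so the quadratic error costs at
   most half of the drop. *)
have le_sqr : (t - 2) ^+ 2 <= slope * logr / L ^+ 2.
  apply: (@le_trans _ _ ((slope / L) ^+ 2)).
    by rewrite ler_sqr ?nnegrE ?divr_ge0 ?(ltW slope_gt0) ?(ltW L_gt0) //; lra.
  rewrite expr_div_n ler_pM2r ?invr_gt0 ?exprn_gt0 //.
  by rewrite ler_pM2l ?slope_gt0 // /slope ge_min lexx.
have -> : slope * logr / 2 / L ^+ 2 = slope * logr / L ^+ 2 / 2 by ring.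
lra.
Qed.

(** The first term is at most [1 + cos (pi / r)], so the slack [1 - cos (pi / r)] must cover
    [slope / L + gap / L ^+ 2]. As [L >= ln 2], the case [L = ln 2] suffices, which is the second
    entry of the minimum in [slope]. *)
Lemma edge_weight_far (q q' : nat) (w : R) :
  w ^+ 2 <= 2 + 2 * cos (pi / r%:R) -> (q <= N)%N ->
  w ^+ 2 / edge_weight q + edge_weight q' <= 4 - gap / L ^+ 2.
Proof.
move=> w_le q_le; have t_ge := edge_weight_ge2 q_le.
have t_le := edge_weight_le q'.
have t_gt0 : 0 < edge_weight q by apply: lt_le_trans t_ge.
have le_half : w ^+ 2 / edge_weight q <= 1 + cos (pi / r%:R).
  apply: (@le_trans _ _ (w ^+ 2 / 2)); last by lra.
  by rewrite ler_wpM2l ?sqr_ge0 // lef_pV2 ?posrE.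
have den_gt0 : 0 < (ln 2)^-1 + logr / 2 / (ln 2) ^+ 2.
  by rewrite addr_gt0 ?invr_gt0 // !divr_gt0 // exprn_gt0.
have le_cost : slope * ((ln 2)^-1 + logr / 2 / (ln 2) ^+ 2) <= 1 - cos (pi / r%:R).
  by rewrite -ler_pdivlMr // /slope ge_min lexx orbT.
have log2_le : ln 2 <= L by rewrite ln_nat_le.
have le1 : slope / L <= slope / ln 2.
  by rewrite ler_pM2l ?slope_gt0 // lef_pV2 ?posrE.
have le2 : gap / L ^+ 2 <= gap / ln 2 ^+ 2.
  by rewrite ler_pM2l ?gap_gt0 // lef_pV2 ?posrE ?exprn_gt0 // ler_sqr // nnegrE ltW.
have gapE : gap / ln 2 ^+ 2 = slope * (logr / 2 / ln 2 ^+ 2).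
  by rewrite /gap -/logr; ring.
rewrite mulrDr -gapE in le_cost; lra.
Qed.

Lemma edge_weight_step (n : nat) : ~~ (N %| n.*2)%N ->
  (2 * cos (angle R N n)) ^+ 2 / edge_weight (dist_multiple N n.*2) +
    edge_weight (dist_multiple N (r * n.*2)) <= 4 - gap / L ^+ 2.
Proof.
move=> N_ndvd; set q := dist_multiple N n.*2.
have q_gt0 : (0 < q)%N by rewrite dist_multiple_gt0 // ltnW.
have q_le : (q <= N)%N by have := double_dist_multiple_le N n.*2; rewrite -/q; lia.
have [near|/ltnW far] := leqP (r * q).*2 N; last first.
  by rewrite edge_weight_far // sqr_cos_angle_le_far.
rewrite dist_multipleM // edge_weight_near ?q_gt0 //.
rewrite sqr_cos_angle //; have := cos_le1 (angle R N n.*2); lra.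
Qed.
End Weights.

(** * From Fourier coefficients to eigenvalues *)

Lemma norm_complexE (R : rcfType) (x : R[i]) : `|x| = ((complex.Re `|x|)%:C)%C.
Proof. by rewrite RRe_real // normr_real. Qed.

Lemma norm_real_complex (R : rcfType) (x : R) : `|(x%:C)%C| = ((`|x|)%:C)%C.
Proof. by rewrite normc_def /= expr0n addr0 sqrtr_sqr. Qed.

Lemma intr_Zp_eq (N : nat) (a b : int) : (1 < N)%N ->
  (a = b %[mod N%:Z])%Z -> a%:~R = b%:~R :> 'Z_N.
Proof.
move=> N_gt1 /eqP; rewrite eqz_mod_dvd => /dvdzP[q ab].
apply/eqP; rewrite -subr_eq0 -rmorphB ab rmorphM /=.
by rewrite -[N%:Z%:~R]/(N%:R) pchar_Zp // mulr0.
Qed.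

Section Eigenvalue.
Variables (R : realType) (r N : nat) (rbar : int).
Hypotheses (r_gt1 : (1 < r)%N) (N_gt1 : (1 < N)%N).
Hypothesis rV : ((r%:Z * rbar)%R = 1 %[mod N%:Z])%Z.

(** The cases are whether the transform of the eigenfunction charges a frequency fixed by [r]. All
    eigenvalues are covered, as the bipartite statement demands; the value 4 comes from frequency
    0. *)
Lemma eigenvalue_dichotomy (l : R[i]) : is_eigenvalue N r rbar l ->
  `|l| <= ((4 - gap R r / (ln (N%:R : R)) ^+ 2)%:C)%C
  \/ exists2 k : nat, (r * k = k %[mod N])%N &
       l = ((4 * cos (angle R N k))%:C)%C.
Proof.
move=> [f [f_neq0 eig]].
have unitV : r%:R * rbar%:~R = 1 :> 'Z_N.
  by have := intr_Zp_eq N_gt1 rV; rewrite rmorphM.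
have r_unit : r%:R \is a @GRing.unit 'Z_N.
  by apply/unitrP; exists rbar%:~R; rewrite mulrC.
have [k0 gk0] := fourier_neq0 N_gt1 f_neq0.
set g := fourier f in gk0.
have eigg k : l * g k = ((2 * cos (angle R N k))%:C)%C * g (rbar%:~R * k) +
    ((2 * cos (angle R N ((r%:R * k)%R : 'Z_N)))%:C)%C * g (r%:R * k).
  rewrite -fourier_adjop // mulr_sumr; apply: eq_bigr => x _.
  by rewrite mulrA eig.
have valr (k : 'Z_N) : (r%:R * k)%R = ((r * k) %% N)%N :> nat.
  by rewrite mulr_natl Zp_mulrn /= mulnC; congr (_ %% _)%N; rewrite Zp_cast.
have [/existsP[k /andP[/eqP k_fixed gk]]|/existsPn nofixed] :=
    boolP [exists k : 'Z_N, (r%:R * k == k) && (g k != 0)].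
  right; exists (k : nat).
    by rewrite -valr k_fixed modn_small // ltn_Zp.
  (* Both frequencies adjacent to a fixed [k] are [k] itself, so the relation reads
     [l * g k = 4 cos (angle k) * g k]. *)
  apply: (mulIf gk); rewrite eigg k_fixed -{2}k_fixed mulrA.
  rewrite [_ * r%:R]mulrC unitV mul1r -mulrDl -rmorphD; congr (_%:C%C * _).
  by rewrite /angle /=; ring.
left; rewrite norm_complexE lecR.
(* The triangle inequality gives the hypothesis of the Schur test for [|g|] and the absolute values
   of the cosines. *)
apply: (@le_of_weighted_schur R 'Z_N (fun k => r%:R * k) (fun k => rbar%:~R * k)
  (fun k => `|2 * cos (angle R N k)|)
  (fun k => edge_weight R r N (dist_multiple N (k : nat).*2))
  (fun k => complex.Re `|g k|)).
- by move=> k; rewrite mulrA [_ * r%:R]mulrC unitV mul1r.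
- by move=> k; rewrite mulrA unitV mul1r.
- move=> k; apply: (@lt_le_trans _ _ 2) => //; apply: edge_weight_ge2 => //.
  by have := double_dist_multiple_le N (k : nat).*2; lia.
- by move=> k; rewrite -ler0c -norm_complexE.
- exists k0; apply: contra gk0 => /eqP a0.
  by rewrite -normr_eq0 norm_complexE a0.
- move=> k; rewrite -lecR rmorphD !rmorphM /= -!norm_complexE -normrM eigg.
  apply: (le_trans (ler_normD _ _)).
  by rewrite ![`|_ * g _|]normrM !norm_real_complex.
(* A frequency charged by [g] is not fixed here, so [N] does not divide its double and its distance
   is positive. *)
move=> k ak; rewrite real_normK ?num_real //.
have -> : dist_multiple N (((r%:R * k)%R : 'Z_N) : nat).*2 =
    dist_multiple N (r * (k : nat).*2).
  by rewrite /dist_multiple valr -!muln2 modnMml mulnA.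
apply: edge_weight_step => //.
have gk : g k != 0 by apply: contra ak => /eqP ->; rewrite normr0.
have := nofixed k; rewrite gk andbT; apply: contra => N_dvd.
by apply/eqP; apply: natr_Zp_fixed.
Qed.
End Eigenvalue.

(** * Parity, the bipartite case and the conclusion *)

Lemma odd_ZpD (N : nat) (x y : 'Z_N) : (1 < N)%N -> ~~ odd N ->
  odd (x + y)%R = odd x (+) odd y.
Proof.
move=> N_gt1 N_even; rewrite -oddD /= -[in RHS](odd_mod _ (negPf N_even)).
by congr (odd (_ %% _)); rewrite Zp_cast.
Qed.

Lemma odd_ZpM (N : nat) (x y : 'Z_N) : (1 < N)%N -> ~~ odd N ->
  odd (x * y)%R = odd x && odd y.
Proof.
move=> N_gt1 N_even; rewrite -oddM /= -[in RHS](odd_mod _ (negPf N_even)).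
by congr (odd (_ %% _)); rewrite Zp_cast.
Qed.

(** Color by parity, which is well defined modulo an even [N]. As [r * rbar] is 1, both factors are
    odd, and every neighbor changes parity. *)
Lemma bipartite_even (N r : nat) (rbar : int) : (1 < N)%N -> ~~ odd N ->
  ((r%:Z * rbar)%R = 1 %[mod N%:Z])%Z -> is_bipartite N r rbar.
Proof.
move=> N_gt1 N_even rV; exists (fun x => odd x).
have : r%:R * rbar%:~R = 1 :> 'Z_N.
  by have := intr_Zp_eq N_gt1 rV; rewrite rmorphM.
move=> /(congr1 (fun x : 'Z_N => odd x)); rewrite odd_ZpM //= => /andP[r_odd rbar_odd].
have oddB1 (x : 'Z_N) : odd (x - 1)%R = ~~ odd x.
  have := odd_ZpD (x - 1) 1 N_gt1 N_even; rewrite subrK /= => ->.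
  by rewrite addbT negbK.
have oddD1 (x : 'Z_N) : odd (x + 1)%R = ~~ odd x.
  by rewrite odd_ZpD // addbT.
move=> x y; rewrite /nbrs !inE => /or4P[] /eqP ->;
  by rewrite ?(oddB1, oddD1, odd_ZpM) // ?r_odd ?rbar_odd ?oddB1 ?oddD1 //; case: odd.
Qed.

Lemma cos_angle_half (R : realType) (N k : nat) : (1 < N)%N ->
  (N %| k.*2)%N -> cos (angle R N k) = 1 \/ cos (angle R N k) = -1.
Proof.
move=> N_gt1 /eqP N_dvd.
have /eqP := sqr_cos_angle R N_gt1 k; rewrite -(cos_angle_mod R N_gt1 k.*2) N_dvd.
rewrite /angle mulr0 mul0r cos0 mulr1 -/(angle R N k) => /eqP sqr_eq.
have : cos (angle R N k) ^+ 2 = 1 by move: sqr_eq; lra.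
by move/eqP; rewrite sqrf_eq1 => /orP[] /eqP; [left | right].
Qed.

Theorem theorem4 (R : realType) (r : nat) (hr : (1 < r)%N) :
  exists2 c : R, 0 < c &
  (forall (N : nat) (rbar : int), (1 < N)%N -> coprime N r ->
     ((r%:Z * rbar)%R = 1 %[mod N%:Z])%Z ->
     forall l : R[i], is_nontrivial_eigenvalue N r rbar l ->
       `|l| <= ((4 - c / (ln (N%:R : R)) ^+ 2)%:C)%C
       \/ exists k : int, ((r%:Z * k)%R = k %[mod N%:Z])%Z /\
            l = ((4 * cos (2 * pi * k%:~R / N%:R))%:C)%C) /\
  (forall (N m : nat) (rbar : int), N = (2 ^ m)%N -> gcdn r.-1 N = 2%N ->
     ((r%:Z * rbar)%R = 1 %[mod N%:Z])%Z ->
     is_bipartite N r rbar /\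
     forall l : R[i], is_eigenvalue N r rbar l -> l != 4 -> l != -4 ->
       `|l| <= ((4 - c / (ln (N%:R : R)) ^+ 2)%:C)%C).
Proof.
exists (gap R r); first exact: gap_gt0.
split=> [N rbar N_gt1 _ rV l [f [f_neq0 [_ eig]]] | N m rbar NE gcd2 rV].
  have [|[k k_fixed ->]] := eigenvalue_dichotomy hr N_gt1 rV (ex_intro _ f (conj f_neq0 eig)).
    by left.
  by right; exists k%:Z; split => //; rewrite -PoszM !modz_nat k_fixed.
have N_even : ~~ odd N by rewrite -dvdn2 -gcd2 dvdn_gcdr.
have N_gt1 : (1 < N)%N.
  by rewrite dvdn_leq //; [rewrite NE expn_gt0 | rewrite dvdn2].
split; first exact: bipartite_even.
move=> l l_eig l_neq4 l_neqN4.
have [//|[k k_fixed lE]] := eigenvalue_dichotomy hr N_gt1 rV l_eig.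
(* [N] divides both [(r - 1) * k] and [N * k], hence their gcd, which is [2 * k]; so the exceptional
   values are only 4 and -4. *)
have N_dvd : (N %| k.*2)%N.
  rewrite -mul2n -gcd2 muln_gcdl dvdn_gcd (dvdn_mulr k (dvdnn N)) andbT.
  rewrite -subn1 mulnBl mul1n; move/eqP: k_fixed.
  by rewrite eqn_mod_dvd // leq_pmull // ltnW.
case/negP: (l_neq4); have [cosE|cosE] := cos_angle_half R N_gt1 N_dvd.
  by rewrite lE cosE mulr1 rmorph_nat.
by case/negP: l_neqN4; rewrite lE cosE mulrN1 rmorphN rmorph_nat.
Qed.
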